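(* Let $X$ be a (real) Hilbert space and let $T:X\to X$ be nonexpansive. Let $x_0\in X$, $y\in\mathrm{Fix}T$ and let $b\in\mathbb{N}$, $b\geq1$, with $\|x_0-y\|\leq b$. Let $\lambda:[0,+\infty)\to[0,1]$ be Lebesgue measurable and let $x$ be the unique strong global solution of \[ \dot x(t)=\lambda(t)\left(T(x(t))-x(t)\right),\qquad x(0)=x_0. \] Let $F:X\to[0,+\infty]$ be given by $F(z):=\|z-Tz\|$ if $\|z-y\|\leq b$ and $F(z):=+\infty$ otherwise, and assume that for some $k>0$ the function $\tau(\varepsilon)=k\varepsilon$ is a modulus of regularity for $F$ w.r.t. $\overline{B}_b(y)$. Assume further that $\underline{\tau}:=\inf_{t\geq0}\lambda(t)(1-\lambda(t))>0$. Then for all $t,s\geq0$: \[ \mathrm{dist}(x(t),\mathrm{Fix}T)\leq c^{\lfloor t\rfloor}\,\mathrm{dist}(x_0,\mathrm{Fix}T)\quad\text{and}\quad\|x(t)-x(t+s)\|\leq2c^{\lfloor t\rfloor}\,\mathrm{dist}(x_0,\mathrm{Fix}T), \] where $c:=(1+\underline{\tau}k^2)^{-1/2}\in(0,1)$.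
   Context: $\mathbb{N}$ contains $0$. $\mathrm{Fix}T$ is the set of fixed points of $T$, $\overline{B}_r(z)$ the closed ball of radius $r$ around $z$, and $\mathrm{zer}F:=\{z\in X\mid F(z)=0\}$ (so here $\mathrm{zer}F=\mathrm{Fix}T\cap\overline{B}_b(y)$). A modulus of regularity for $F$ w.r.t. $\overline{B}_b(y)$ is a function $\tau:(0,\infty)\to(0,\infty)$ such that for all $\varepsilon>0$ and all $u\in\overline{B}_b(y)$: $F(u)<\tau(\varepsilon)$ implies $\mathrm{dist}(u,\mathrm{zer}F)<\varepsilon$. A strong global solution is a function $x:[0,+\infty)\to X$ which is absolutely continuous on each interval $[0,a]$, $a\in(0,\infty)$, satisfies $x(0)=x_0$, and satisfies the differential equation almost everywhere on $[0,+\infty)$; under the stated assumptions it exists and is unique. *)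

(* Defs.v *)
From HB Require Import structures.
From mathcomp Require Import all_boot all_order all_algebra.
From mathcomp Require Import all_classical all_reals all_analysis.
From mathcomp Require Import measurable_realfun.

Set Implicit Arguments.
Unset Strict Implicit.
Unset Printing Implicit Defensive.
Import Order.TTheory GRing.Theory Num.Theory.
Import numFieldNormedType.Exports.
Local Open Scope classical_set_scope.
Local Open Scope ring_scope.

Definition nonexpansive (R : realType) (X : normedModType R) (T : X -> X) :=
  forall u v, `|T u - T v| <= `|u - v|.

Definition Fix (X : Type) (T : X -> X) : set X := [set z | T z = z].

Definition zer (R : realType) (X : Type) (F : X -> \bar R) : set X :=
  [set z | F z = 0%E].

(* The distance to a set is [edist_inf], with values in \bar R, which is +oo
   for the empty set (the real-valued [inf] would give 0 there). The values
   of [tau] at nonpositive reals are irrelevant. *)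
Definition modulus_of_regularity (R : realType) (X : normedModType R)
    (F : X -> \bar R) (A : set X) (tau : R -> R) :=
  forall eps : R, 0 < eps ->
    0 < tau eps /\
    forall u, A u -> (F u < (tau eps)%:E)%E ->
      (edist_inf (zer F) u < eps%:E)%E.

Definition local_residual (R : realType) (X : normedModType R) (T : X -> X)
    (y : X) (r : R) (z : X) : \bar R :=
  if `|z - y| <= r then `|z - T z|%:E else +oo%E.

(* Measurability with respect to the completion of the Borel sigma-algebra of
   the line for the Lebesgue measure; the default structure on R gives only
   Borel measurability. *)
Definition lebesgue_measurable_fun (R : realType) (D : set R) (f : R -> R) :=
  @measurable_fun _ _
    (g_sigma_algebraType (completed_algebra_gen (@lebesgue_measure R)))
    (measurableTypeR R) D f.

Definition absolutely_continuous_on (R : realType) (X : normedModType R)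
    (l r : R) (f : R -> X) :=
  forall eps : R, 0 < eps -> exists2 delta : R, 0 < delta &
    forall (n : nat) (u v : 'I_n -> R),
      (forall i, l <= u i <= v i /\ v i <= r) ->
      trivIset setT (fun i => `]u i, v i[%classic) ->
      \sum_(i < n) (v i - u i) < delta ->
      \sum_(i < n) `|f (v i) - f (u i)| < eps.

(* Functions on [0, +oo[ are represented by functions on R whose values at
   negative reals are irrelevant: two-sided differentiability at 0 is dispensed
   with by the "almost everywhere". *)
Definition strong_global_solution (R : realType) (X : normedModType R)
    (T : X -> X) (lam : R -> R) (x0 : X) (x : R -> X) :=
  [/\ forall a, 0 < a -> absolutely_continuous_on 0 a x,
      x 0 = x0 &
      {ae @lebesgue_measure R, forall t : R, 0 <= t ->
        is_derive t 1 x (lam t *: (T (x t) - x t))}].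

Definition tau_low (R : realType) (lam : R -> R) : R :=
  inf [set lam t * (1 - lam t) | t in `[0, +oo[].

(* Main.v *)
Require Import Defs.
From mathcomp Require Import all_boot all_order all_algebra.
From mathcomp Require Import all_classical all_reals all_analysis.
From mathcomp Require Import measurable_realfun.
From mathcomp Require Import lra.
Import Order.TTheory GRing.Theory Num.Theory.
Import numFieldNormedType.Exports.
Local Open Scope classical_set_scope.
Local Open Scope ring_scope.

(** For a fixed point [p] of [T], nonexpansiveness reads
    [2 <u - p, T u - u> <= - `|u - T u|^2], so along the trajectory
    [d/dt `|x t - p|^2 <= - lam t * `|x t - T (x t)|^2] almost everywhere, and
    [lam t >= lam t * (1 - lam t) >= tau_low lam =: tau]. Hence every
    [`|x t - p|] is nonincreasing (Fejer monotonicity, [fejer_decrease]); in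
    particular [x] stays in the ball around [y] on which regularity is
    available, and the distance [D t] of [x t] to the fixed points is
    nonincreasing.

    The linear modulus of regularity implies that
    [k * dist (u, Fix T) <= `|u - T u|] on that ball
    ([regularity_residual_ge]). On [[t, t + 1]] the residual is therefore at
    least [k * D (t + 1)], and integrating the differential inequality gives,
    for every fixed point [p],
    [(1 + tau * k^2) * D (t + 1)^2 <= `|x t - p|^2]. Taking the infimum over [p]
    yields [D (t + 1) <= c * D t]; iterating [floor t] times and using
    monotonicity of [D] on what is left gives the first estimate. The second one
    follows because both [x t] and [x (t + s)] are within [`|x t - p|] of each
    fixed point [p].

    Integrating the differential inequality means that an absolutely continuous
    real function whose derivative is at most [C] almost everywhere grows at
    rate at most [C] ([ac_le_of_ae_derive_le]). This is proved without
    integration: by compactness of the interval in the form of Cousin's lemma,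
    there is a finite subdivision each piece of which either satisfies the
    growth estimate up to an arbitrary error (near the points where the
    derivative bound holds) or lies in an open set of small measure (near the
    exceptional points), where absolute continuity controls the total growth. *)

(** * Growth of absolutely continuous functions *)

(** Cousin's lemma in the form of an induction principle: a property of
    intervals that is additive under juxtaposition and holds for all small
    intervals around each point holds for the whole interval. The supremum of
    the [s] such that [P a s] is reached and cannot be less than [b]. *)
Lemma cousin (R : realType) (P : R -> R -> Prop) (a b : R) :
  a <= b ->
  (forall u v w, u <= v <= w -> P u v -> P v w -> P u w) ->
  (forall t, a <= t <= b -> exists2 d, 0 < d &
     forall u v, a <= u <= t -> t <= v <= b -> v - u < d -> P u v) ->
  P a b.
Proof.
move=> ab Ptrans Ploc; pose S := [set s | a <= s <= b /\ P a s].
have aS : S a.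
  split; first by rewrite lexx.
  have [|d d0] := Ploc a; first by rewrite lexx.
  by apply; rewrite ?lexx ?ab // subrr.
have Sub : ubound S b by move=> s [/andP[]].
have hS : has_sup S by split; [exists a | exists b].
have aU : a <= sup S by apply: ub_le_sup => //; exists b.
have Ub : sup S <= b by apply: ge_sup => //; exists a.
have [|d d0 Pd] := Ploc (sup S); first by rewrite aU.
have [s [sab Pas] ds] : exists2 s, S s & sup S - d / 2 < s.
  by apply: sup_adherent => //; rewrite divr_gt0.
have sU : s <= sup S by apply: ub_le_sup => //; exists b.
have [as_ sb] := andP sab.
pose v := Num.min b (sup S + d / 4).
have Uv : sup S <= v by rewrite /v le_min; lra.
have vb : v <= b by rewrite /v ge_min; lra.
have vd : v <= sup S + d / 4 by rewrite /v ge_min; lra.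
have Pav : P a v.
  apply: (Ptrans a s v) => //; first by rewrite as_ (le_trans sU).
  by apply: Pd; rewrite ?as_ ?sU ?Uv ?vb //; lra.
have vS : v <= sup S.
  by apply: ub_le_sup; [exists b|split => //; rewrite vb andbT (le_trans aU)].
suff <- : v = b by [].
by move: vS; rewrite /v; case: (leP b (sup S + d / 4)) => // _; lra.
Qed.

(** The interval [[u, v]] only has to straddle [t]: the first order expansion at
    [t] is used on both sides, and the two errors add up to
    [e * ((v - t) + (t - u))]. *)
Lemma derive_straddle (R : realType) (f : R -> R) (t C e : R) :
  derivable f t 1 -> 'D_1 f t <= C -> 0 < e ->
  exists2 d, 0 < d & forall u v, u <= t <= v -> v - u < d ->
    f v - f u <= (C + e) * (v - u).
Proof.
move=> ft fC e0.
have /cvgrPdist_lt /(_ e e0) :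
    h^-1 *: ((f \o shift t) (h *: (1:R)) - f t) @[h --> 0^'] --> 'D_1 f t.
  exact: ft.
move=> /nbhs_ballP [d /= d0 H]; exists d => // u v /andP[ut tv] vud.
have K w : `|w - t| < d -> `|f w - f t - 'D_1 f t * (w - t)| <= e * `|w - t|.
  move=> wt; have [->|wNt] := eqVneq w t.
    by rewrite !subrr mulr0 subr0 normr0 mulr0.
  have := H (w - t); rewrite /ball /= sub0r normrN => /(_ wt).
  have wt0 : w - t != 0 by rewrite subr_eq0.
  move=> /(_ wt0); rewrite scaler1 subrK => /ltW Hw.
  have -> : f w - f t - 'D_1 f t * (w - t) =
      - (('D_1 f t - (w - t)^-1 *: (f w - f t)) * (w - t)).
    by rewrite mulrBl /GRing.scale/= mulrAC mulVf // mul1r opprB.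
  by rewrite normrN normrM ler_wpM2r.
have := K v; have := K u.
rewrite (ger0_norm (_ : 0 <= v - t)) ?subr_ge0 //.
rewrite (ler0_norm (_ : u - t <= 0)) ?subr_le0 //.
move=> /(_ ltac:(lra)) /ler_normlP [A1 A2] /(_ ltac:(lra)) /ler_normlP [B1 B2].
have : 'D_1 f t * (v - u) <= C * (v - u) by rewrite ler_wpM2r//; lra.
lra.
Qed.

(** Away from the null set [N] of exceptional points the derivative gives the
    growth estimate [A] on small intervals; around points of [N], small
    intervals lie in an open [U] of measure less than [d'] covering [N]. On the
    pieces of the second kind the total growth of [f] is at most [e / 2] by
    absolute continuity. *)
Lemma ac_le_of_ae_derive_le (R : realType) (f : R -> R) (l r C : R) :
  l <= r -> absolutely_continuous_on l r f ->
  {ae @lebesgue_measure R, forall t, l <= t <= r ->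
     derivable f t 1 /\ 'D_1 f t <= C} ->
  f r - f l <= C * (r - l).
Proof.
move=> lr fac [N [mN N0 Nsub]].
suff Heps e : 0 < e -> f r - f l <= (C + e) * (r - l) + e.
  apply/ler_addgt0Pr => e e0.
  have d0 : 0 < r - l + 1 by lra.
  have := Heps (e / (r - l + 1)) (divr_gt0 e0 d0).
  rewrite mulrDl -addrA -{2}[_ / _]mulr1 -mulrDr divfK ?lt0r_neq0 //.
move=> e0.
have e20 : 0 < e / 2 by rewrite divr_gt0.
have [d d0 fd] := fac _ e20.
(* On the pieces lying in [U] the bound [(C + e) * (v - u)] is added and
   subtracted; [d'] is small enough for the part added to cost at most
   [e / 2], whatever the sign of [C + e]. *)
set K := `|C + e|.
pose d' := Num.min d (e / 2 / (K + 1)).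
have K0 : 0 <= K by exact: normr_ge0.
have d'0 : 0 < d' by rewrite lt_min d0 divr_gt0 //; lra.
have dd : d' <= d by rewrite /d' ge_min lexx.
have Kd : K * d' <= e / 2.
  apply: (@le_trans _ _ ((K + 1) * d')); first by apply: ler_wpM2r; lra.
  by rewrite mulrC -ler_pdivlMr ?ge_min ?lexx ?orbT //; lra.
have Nfin : (lebesgue_measure N < +oo)%E by rewrite N0 ltry.
have [U [oU NU Ud]] := lebesgue_regularity_outer mN Nfin d'0.
have mU : measurable U by exact: open_measurable.
have muU : (lebesgue_measure U < d'%:E)%E.
  apply: le_lt_trans Ud; rewrite -(setDUK NU) -[leRHS]add0e -N0.
  rewrite setDUK //; apply: le_trans (measureU2 _ _ _) => //;
    last exact: measurableD.
  by rewrite setDUK.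
pose A u v := f v - f u <= (C + e) * (v - u).
pose B u v := `[u, v] `<=` U.
pose step u v := (u <= v) && (A u v || `[< B u v >]).
have [s [sp sl]] : exists s, path step l s /\ last l s = r.
  apply: (@cousin _ (fun u v => exists s, path step u s /\ last u s = v)) => //.
    move=> u v w _ [s [sp <-]] [s' [sp' <-]]; exists (s ++ s').
    by rewrite cat_path last_cat sp.
  move=> t tlr; have [Nt|Nt] := pselect (N t).
    have /nbhs_ballP [d1 /= d10 H] : nbhs t U.
      by apply: open_nbhs_nbhs; split => //; exact: NU.
    exists d1 => // u v /andP[_ ut] /andP[tv _] vu.
    exists [:: v]; rewrite /= andbT; split=> //.
    apply/andP; split; first exact: le_trans tv.
    apply/orP; right; apply/asboolP => z /=.
    rewrite in_itv /= => /andP[uz zv].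
    by apply: H; rewrite /ball /= ltr_norml; lra.
  have [ft fC] : derivable f t 1 /\ 'D_1 f t <= C.
    by apply: contrapT => H; apply: Nt; apply: Nsub => /= /(_ tlr).
  have [d1 d10 H] := derive_straddle _ _ _ _ _ ft fC e0.
  exists d1 => // u v /andP[_ ut] /andP[tv _] vu.
  exists [:: v]; rewrite /= andbT; split=> //.
  apply/andP; split; first exact: le_trans tv.
  by apply/orP; left; apply: H; rewrite ?ut.
(* The points of the subdivision are extended by [r] beyond the last index, so
   that [p] is monotone on all of [nat]. *)
pose n := size s; pose p i := nth r (l :: s) i.
have pn i : (n <= i)%N -> p i = r.
  rewrite leq_eqVlt => /predU1P[<-|ni]; last by rewrite /p nth_default.
  by rewrite /p -[n]/((size (l :: s)).-1) nth_last.
have pstep i : (i < n)%N -> step (p i) (p i.+1).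
  by move=> ilt; have /pathP := sp; move=> /(_ r i ilt).
have pS i : p i <= p i.+1.
  have [/pstep/andP[]//|ni] := ltnP i n.
  by rewrite !pn // ltnW.
have pmono : {homo p : i j / (i <= j)%N >-> i <= j}.
  by apply: homo_leq => //; exact: le_trans.
(* The pieces satisfying [A] are collapsed to a point: the intervals [F i] that
   remain are disjoint and contained in [U]. *)
pose q i := if A (p i) (p i.+1) then p i else p i.+1.
have pq i : p i <= q i by rewrite /q; case: ifP.
have qp i : q i <= p i.+1 by rewrite /q; case: ifP.
pose F i := `]p i, q i[%classic.
have Ftriv : trivIset setT F.
  apply: ltn_trivIset => j i ij; apply/seteqP; split => // z [].
  rewrite /F /= !in_itv /= => /andP[_ zq] /andP[pz _].
  have := pmono _ _ ij; have := qp i; have := qp j; lra.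
have FU i : F i `<=` U.
  rewrite /F /q; case: ifPn => HA; first by rewrite set_itvoo0.
  have [/pstep/andP[_]|ni] := ltnP i n.
    rewrite (negPf HA) /= => /asboolP; apply: subset_trans.
    by apply: subset_itv; rewrite bnd_simp.
  by rewrite !pn ?set_itvoo0 // ltnW.
have muF i : lebesgue_measure (F i) = (q i - p i)%:E.
  rewrite /F lebesgue_measure_itv /= lte_fin.
  by have := pq i; rewrite le_eqVlt => /predU1P[->|->//]; rewrite ltxx subrr.
have Fsum : \sum_(i < n) (q i - p i) < d'.
  rewrite -lte_fin; apply: le_lt_trans muU.
  have -> : (\sum_(i < n) (q i - p i))%:E =
      lebesgue_measure (\big[setU/set0]_(i < n) F i).
    rewrite measure_bigsetU //; last by move=> i; exact: measurable_itv.
    by rewrite -sumEFin; apply: eq_bigr => i _; exact/esym/muF.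
  apply: le_measure; rewrite ?inE //.
    by apply: bigsetU_measurable => i _; exact: measurable_itv.
  by rewrite -bigcup_mkord; apply: bigcup_sub => i _; exact: FU.
have fsum : \sum_(i < n) `|f (q i) - f (p i)| < e / 2.
  apply: (fd n (p \o val) (q \o val)) => /=.
  - move=> i; rewrite pq (pmono 0%N i) //; split=> //.
    by rewrite (le_trans (qp i)) // -(pn n) //; apply: pmono.
  - move=> i j _ _ H; apply/val_inj; apply: Ftriv => //.
  - exact: lt_le_trans dd.
have tele g : g r - g l = \sum_(i < n) (g (p i.+1) - g (p i)) :> R.
  rewrite -(big_mkord xpredT (fun i => g (p i.+1) - g (p i))).
  by rewrite (telescope_sumr (g \o p)) //= pn.
have : f r - f l <= (C + e) * (r - l) +
    (\sum_(i < n) `|f (q i) - f (p i)| + K * \sum_(i < n) (q i - p i)).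
  rewrite (tele f) (tele id) !mulr_sumr -!big_split /=; apply: ler_sum => i _.
  rewrite /q; case: ifP => [HA|_]; first by rewrite !subrr normr0 mulr0 !addr0.
  have := ler_norm (f (p i.+1) - f (p i)).
  have : - ((C + e) * (p i.+1 - p i)) <= K * (p i.+1 - p i).
    rewrite -mulNr ler_wpM2r ?subr_ge0 // /K -normrN; exact: ler_norm.
  lra.
have : K * \sum_(i < n) (q i - p i) <= K * d' by rewrite ler_wpM2l // ltW.
lra.
Qed.

(** Boundedness is additive under juxtaposition, and on an interval shorter than
    the [delta] of absolute continuity for [eps = 1] the values stay within [1]
    of one of them. *)
Lemma ac_bounded (R : realType) (X : normedModType R) (f : R -> X) (l r : R) :
  l <= r -> absolutely_continuous_on l r f ->
  exists M, forall t, l <= t <= r -> `|f t| <= M.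
Proof.
move=> lr fac; have [d d0 fd] := fac 1 ltr01.
apply: (@cousin _
  (fun u v => exists M, forall t, u <= t <= v -> `|f t| <= M) l r lr).
  move=> u v w uvw [M HM] [M' HM']; exists (Num.max M M') => t /andP[ut tw].
  have [tv|vt] := leP t v; first by rewrite le_max HM ?ut.
  by rewrite le_max HM' ?orbT // tw ltW.
move=> t tlr; exists d => // u v /andP[lu ut] /andP[tv vr] vud.
exists (`|f u| + 1) => z /andP[uz zv].
rewrite -lerBlDl; apply: le_trans (lerB_dist _ _) _.
have := fd 1 (fun=> u) (fun=> z); rewrite !big_ord1 => H; apply/ltW/H.
- by move=> _; rewrite lu uz (le_trans zv).
- by move=> i j _ _ _; rewrite !ord1.
- by apply: le_lt_trans vud; rewrite lerB.
Qed.

(** On the bounded range of [f], the map [`|. - w| ^+ 2] is Lipschitz, with a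
    constant below [K]. *)
Lemma ac_sqr_norm (R : realType) (X : normedModType R) (f : R -> X) (w : X)
    (l r : R) :
  l <= r -> absolutely_continuous_on l r f ->
  absolutely_continuous_on l r (fun t => `|f t - w| ^+ 2 : R).
Proof.
move=> lr fac e e0; have [M HM] := ac_bounded _ _ _ _ _ lr fac.
have M0 : 0 <= M by apply: le_trans (HM l _); rewrite ?lexx.
pose K := 2 * (M + `|w|) + 1.
have K0 : 0 < K by rewrite /K; have := normr_ge0 w; lra.
have [d d0 fd] := fac (e / K) (divr_gt0 e0 K0); exists d => // n u v uv triv sumd.
have := fd n u v uv triv sumd; rewrite ltr_pdivlMr // mulr_suml => H.
apply: le_lt_trans H; apply: ler_sum => i _.
have [/andP[lu uvi] vr] := uv i.
have nb t : l <= t <= r -> `|f t - w| <= M + `|w|.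
  by move=> tlr; apply: le_trans (ler_normB _ _) _; rewrite lerD2r HM.
have b1 := nb (u i); have b2 := nb (v i).
rewrite subr_sqr normrM; apply: ler_pM => //.
  by apply: le_trans (ler_dist_dist _ _) _; rewrite opprB addrA subrK.
rewrite ger0_norm ?addr_ge0 // /K.
have := b1 ltac:(rewrite lu (le_trans uvi) //).
have := b2 ltac:(rewrite vr (le_trans lu) //); lra.
Qed.

(** * The inner product along a trajectory *)

Lemma dot_sqr_norm_diff (R : realType) (X : normedModType R)
    (dot : {dot X for (@idfun R)})
    (norm_dot : forall u : X, `|u| ^+ 2 = dot u u)
    (u v : X) :
  `|u| ^+ 2 - `|v| ^+ 2 = dot (u - v) (u + v).
Proof.
rewrite linearBl /= !linearDr /= -!norm_dot (hermC dot v u) expr0 mul1r /=; lra.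
Qed.

(** This expresses [dot] through the norm alone, hence gives its continuity. *)
Lemma dot_polarization (R : realType) (X : normedModType R)
    (dot : {dot X for (@idfun R)})
    (norm_dot : forall u : X, `|u| ^+ 2 = dot u u)
    (u v : X) :
  dot u v = 4^-1 * (`|u + v| ^+ 2 - `|u - v| ^+ 2).
Proof.
rewrite !norm_dot linearDl linearBl /= !linearDr !linearNr /=.
rewrite (hermC dot v u) expr0 mul1r /=; lra.
Qed.

(** By [dot_sqr_norm_diff] the difference quotient is [dot (Q h) (S h)], with
    [Q] the difference quotient of [x] and [S h] tending to
    [2 *: (x t - w)]. *)
Lemma is_derive_sqr_norm (R : realType) (X : normedModType R)
    (dot : {dot X for (@idfun R)})
    (norm_dot : forall u : X, `|u| ^+ 2 = dot u u)
    (x : R -> X) (t : R) (w v : X) :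
  is_derive t 1 x v ->
  is_derive t (1 : R) (fun s => `|x s - w| ^+ 2 : R) (2 * dot (x t - w) v).
Proof.
move=> [xt xv].
have xcont : x (h + t) @[h --> 0^'] --> x t.
  have /derivable1_diffP/differentiable_continuous xc := xt.
  have H : (h + t) @[h --> (0:R)^'] --> t.
    rewrite -[X in _ --> X]add0r; apply: cvgD; last exact: cvg_cst.
    exact: cvg_within.
  exact: (cvg_comp _ _ H xc).
pose Q h := h^-1 *: (x (h + t) - x t).
pose S h := (x (h + t) - w) + (x t - w).
have Qv : Q h @[h --> 0^'] --> v.
  have : h^-1 *: ((x \o shift t) (h *: (1:R)) - x t) @[h --> 0^'] --> v.
    by rewrite -xv; exact: xt.
  by apply: cvg_trans; apply: near_eq_cvg; near=> h; rewrite /Q /= scaler1.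
have Sv : S h @[h --> 0^'] --> (x t - w) + (x t - w).
  by apply: cvgD; [apply: cvgB => //; exact: cvg_cst|exact: cvg_cst].
have sqcvg (G : R -> X) g : G h @[h --> 0^'] --> g ->
    (`|G h| ^+ 2 : R) @[h --> 0^'] --> (`|g| ^+ 2 : R).
  move=> Gg; rewrite expr2; under eq_fun do rewrite expr2.
  by apply: cvgM; exact: cvg_norm.
have dotcvg : dot (Q h) (S h) @[h --> 0^'] --> dot v ((x t - w) + (x t - w)).
  rewrite (dot_polarization _ _ _ norm_dot).
  under eq_fun do rewrite (dot_polarization _ _ _ norm_dot).
  apply: cvgM; first exact: cvg_cst.
  by apply: cvgB; apply: sqcvg; [apply: cvgD|apply: cvgB].
have lim2 :
    h^-1 *: (((fun s => `|x s - w| ^+ 2 : R) \o shift t) (h *: (1:R)) -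
      `|x t - w| ^+ 2) @[h --> 0^'] --> 2 * dot (x t - w) v.
  have -> : 2 * dot (x t - w) v = dot v ((x t - w) + (x t - w)).
    rewrite linearDr /= (hermC dot (x t - w) v) expr0 mul1r /=; lra.
  apply: cvg_trans dotcvg; apply: near_eq_cvg; near=> h.
  rewrite /= scaler1 (dot_sqr_norm_diff _ _ _ norm_dot) /Q /S linearZl_LR /=.
  by congr (_ * dot _ _); rewrite opprB addrA subrK.
split; first by apply/cvg_ex; exists (2 * dot (x t - w) v).
exact: cvg_lim lim2.
Unshelve. all: by end_near. Qed.

(** Expand [`|T u - p|^2 <= `|u - p|^2] along [T u - p = (T u - u) + (u - p)]. *)
Lemma dot_residual_le (R : realType) (X : normedModType R)
    (dot : {dot X for (@idfun R)})
    (norm_dot : forall u : X, `|u| ^+ 2 = dot u u)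
    (T : X -> X) (p u : X) :
  nonexpansive T -> Fix T p -> 2 * dot (u - p) (T u - u) <= - `|u - T u| ^+ 2.
Proof.
move=> Tne Tp; have : `|T u - p| ^+ 2 <= `|u - p| ^+ 2.
  by rewrite lerXn2r ?nnegrE // -{1}Tp.
have -> : T u - p = (T u - u) + (u - p) by rewrite addrA subrK.
rewrite (distrC u (T u)) !norm_dot; move: (T u - u) (u - p) => w v.
rewrite linearDl /= !linearDr /= (hermC dot w v) expr0 mul1r /=; lra.
Qed.

(** The constant [m] stands for a lower bound of the residual; [m = 0] gives
    Fejer monotonicity, and the positive value supplied by regularity gives the
    contraction of the distance over a unit of time. *)
Lemma fejer_decrease (R : realType) (X : normedModType R)
    (dot : {dot X for (@idfun R)})
    (norm_dot : forall u : X, `|u| ^+ 2 = dot u u)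
    (T : X -> X) (x0 p : X) (lam : R -> R) (x : R -> X) (tau m s t : R) :
  nonexpansive T -> Fix T p ->
  strong_global_solution T lam x0 x ->
  0 <= tau -> (forall r, 0 <= r -> tau <= lam r) ->
  0 <= s <= t -> 0 <= m ->
  (forall r, s <= r <= t -> m <= `|x r - T (x r)|) ->
  `|x t - p| ^+ 2 + tau * m ^+ 2 * (t - s) <= `|x s - p| ^+ 2.
Proof.
move=> Tne Tp [xac _ xode] tau0 taulam /andP[s0 st] m0 mres.
have t0 : 0 <= t by exact: le_trans st.
have xst : absolutely_continuous_on s t x.
  move=> e e0; have [|d d0 xd] := xac (t + 1) _ e e0; first by lra.
  exists d => // n u v uv; apply: xd => i; have [/andP[su ->] vt] := uv i.
  by rewrite (le_trans s0 su); split => //; lra.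
suff : `|x t - p| ^+ 2 - `|x s - p| ^+ 2 <= - (tau * m ^+ 2) * (t - s) by lra.
apply: (@ac_le_of_ae_derive_le _ (fun r => `|x r - p| ^+ 2)) => //.
  exact: ac_sqr_norm.
apply: negligibleS xode; apply: subsetC => r /= xr /andP[sr rt].
have r0 : 0 <= r by exact: le_trans sr.
have [gr gr'] := is_derive_sqr_norm _ _ _ norm_dot _ _ p _ (xr r0).
split; first exact: gr.
rewrite gr' linearZr_LR /= mulrCA.
have H := dot_residual_le _ _ _ norm_dot _ _ (x r) Tne Tp.
have lr := taulam _ r0; have l0 := le_trans tau0 lr.
apply: (@le_trans _ _ (lam r * - `|x r - T (x r)| ^+ 2)); first exact: ler_wpM2l.
rewrite mulrN lerN2; apply: ler_pM => //; first exact: exprn_ge0.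
by rewrite lerXn2r ?nnegrE // mres // sr.
Qed.

(** * Distance to the fixed points *)

Lemma edist_norm (R : realType) (X : normedModType R) (u v : X) :
  edist (u, v) = `|u - v|%:E.
Proof.
apply/eqP; rewrite eq_le; apply/andP; split.
  apply/lee_addgt0Pr => e e0; rewrite -EFinD; apply: edist_fin => /=.
    by rewrite ltr_wpDl.
  by rewrite -ball_normE /ball_ /= ltrDl.
apply: le_ereal_inf_tmp => _ [r [_ uv] <-]; move: uv.
by rewrite -ball_normE /ball_ /= lee_fin => /ltW.
Qed.

Lemma edist_inf_leP (R : realType) (X : normedModType R) (A : set X) (u : X)
    (m : R) :
  (m%:E <= edist_inf A u)%E <-> forall p, A p -> m <= `|u - p|.
Proof.
split=> [/ereal_infP H p Ap|H].
  by have := H _ (ex_intro2 _ _ p Ap erefl); rewrite edist_norm lee_fin.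
by apply/ereal_infP => _ [p Ap <-]; rewrite edist_norm lee_fin H.
Qed.

(** If the residual were less than [k * m] with [m] positive, regularity with
    [eps = m] would put [u] at distance less than [m] from the zeros of the
    residual, which are fixed points. *)
Lemma regularity_residual_ge (R : realType) (X : normedModType R)
    (T : X -> X) (y u : X) (b k m : R) :
  0 < k ->
  modulus_of_regularity (local_residual T y b)
    (closed_ball_ Num.norm y b) (fun eps => k * eps) ->
  `|u - y| <= b -> (m%:E <= edist_inf (Fix T) u)%E ->
  k * m <= `|u - T u|.
Proof.
move=> k0 reg ub mD.
have [m0|m0] := leP m 0.
  by apply: le_trans (normr_ge0 _); rewrite pmulr_rle0.
rewrite leNgt; apply/negP => H.
have [_ /(_ u)] := reg m m0.
rewrite /closed_ball_ /= distrC /local_residual ub lte_fin => /(_ erefl H).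
apply/negP; rewrite -leNgt; apply: le_trans mD _.
apply: le_ereal_inf => _ [z zF <-]; exists z => //; move: zF.
rewrite /zer /= /local_residual; case: ifP => // _ [] /eqP.
by rewrite normr_eq0 subr_eq0 => /eqP.
Qed.

(** * Linear convergence *)

Theorem theorem4p8 (R : realType) (X : completeNormedModType R)
    (dot : {dot X for (@idfun R)}) (norm_dot : forall u : X, `|u| ^+ 2 = dot u u)
    (T : X -> X) (x0 y : X) (b : nat) (lam : R -> R) (x : R -> X) (k : R) :
  nonexpansive T ->
  Fix T y ->
  (1 <= b)%N ->
  `|x0 - y| <= b%:R ->
  (forall t : R, 0 <= t -> 0 <= lam t <= 1) ->
  lebesgue_measurable_fun `[0, +oo[ lam ->
  strong_global_solution T lam x0 x ->
  0 < k ->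
  modulus_of_regularity (local_residual T y b%:R)
    (closed_ball_ Num.norm y b%:R) (fun eps => k * eps) ->
  0 < tau_low lam ->
  let c := (1 + tau_low lam * k ^+ 2) `^ (- 2^-1) in
  0 < c < 1 /\
  forall t s : R, 0 <= t -> 0 <= s ->
    (edist_inf (Fix T) (x t) <=
       (c ^ Num.floor t)%:E * edist_inf (Fix T) x0)%E /\
    (`|x t - x (t + s)|%:E <=
       (2 * c ^ Num.floor t)%:E * edist_inf (Fix T) x0)%E.
Proof.
move=> Tne Ty _ x0b lam01 _ xsol k0 reg tau0 c.
set tau := tau_low lam in tau0 c *.
have taulam r : 0 <= r -> tau <= lam r.
  move=> r0; apply: (@le_trans _ _ (lam r * (1 - lam r))).
    apply: ge_inf; last by exists r => //=; rewrite in_itv /= andbT.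
    exists 0 => _ [q + <-]; rewrite /= in_itv /= andbT => /lam01/andP[l0 l1].
    by rewrite mulr_ge0 // subr_ge0.
  by have /andP[l0 l1] := lam01 _ r0; nra.
have x0E : x 0 = x0 by case: xsol.
have decr p s t m : Fix T p -> 0 <= s <= t -> 0 <= m ->
    (forall r, s <= r <= t -> m <= `|x r - T (x r)|) ->
    `|x t - p| ^+ 2 + tau * m ^+ 2 * (t - s) <= `|x s - p| ^+ 2.
  move=> Tp.
  exact: (fejer_decrease _ _ _ norm_dot _ _ _ _ _ _ _ _ _ Tne Tp xsol
            (ltW tau0) taulam).
have fejer p s t : Fix T p -> 0 <= s <= t -> `|x t - p| <= `|x s - p|.
  move=> Tp st; rewrite -ler_sqr ?nnegrE //.
  have := decr p s t 0 Tp st (lexx _) (fun _ _ => normr_ge0 _).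
  by rewrite expr0n /= mulr0 mul0r addr0.
(* The set of fixed points contains [y], so the distance is finite. *)
pose D t := fine (edist_inf (Fix T) (x t)).
have DE t : edist_inf (Fix T) (x t) = (D t)%:E.
  rewrite /D fineK // ge0_fin_numE ?edist_inf_ge0 //.
  apply: (@le_lt_trans _ _ `|x t - y|%:E); last exact: ltry.
  by rewrite -edist_norm; apply: ereal_inf_lbound; exists y.
have D0 t : 0 <= D t by rewrite -lee_fin -DE edist_inf_ge0.
have DP t m : m <= D t <-> forall p, Fix T p -> m <= `|x t - p|.
  by rewrite -lee_fin -DE; exact: edist_inf_leP.
have Dle t p : Fix T p -> D t <= `|x t - p| by apply: (DP t _).1.
have Dmono s t : 0 <= s <= t -> D t <= D s.
  by move=> st; apply/DP => p Tp; apply: le_trans (Dle t p Tp) (fejer p s t Tp st).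
have res r m : 0 <= r -> m <= D r -> k * m <= `|x r - T (x r)|.
  move=> r0 mD; apply: (regularity_residual_ge _ _ _ _ _ _ _ _ k0 reg) => //.
    by apply: le_trans x0b; rewrite -x0E; apply: fejer; rewrite // lexx.
  by rewrite DE lee_fin.
have a0 : 0 < tau * k ^+ 2 by rewrite mulr_gt0 // exprn_gt0.
have a1 : 0 < 1 + tau * k ^+ 2 by lra.
have c0 : 0 < c by apply: powR_gt0.
have c2 : c ^+ 2 * (1 + tau * k ^+ 2) = 1.
  rewrite /c; move: (1 + tau * k ^+ 2) a1 => a a1.
  rewrite -powR_mulrn ?powR_ge0 // -powRrM mulNr mulVf // powRN.
  by rewrite powRr1 ?mulVf ?lt0r_neq0 // ltW.
have c1 : c < 1.
  rewrite ltNge; apply/negP => c1.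
  have : 1 <= c ^+ 2 by rewrite exprn_ege1.
  nra.
have Dstep t : 0 <= t -> D (t + 1) <= c * D t.
  move=> t0; rewrite -ler_pdivrMl //; apply/DP => p Tp.
  have t01 : 0 <= t <= t + 1 by lra.
  have tres r : t <= r <= t + 1 -> k * D (t + 1) <= `|x r - T (x r)|.
    by move=> /andP[tr rt]; apply: res; [|apply: Dmono]; lra.
  have := decr p t (t + 1) (k * D (t + 1)) Tp t01 (mulr_ge0 (ltW k0) (D0 _)) tres.
  have : D (t + 1) ^+ 2 <= `|x (t + 1) - p| ^+ 2.
    by rewrite lerXn2r ?nnegrE ?Dle.
  rewrite -(@ler_sqr _ (c^-1 * _)) ?nnegrE ?mulr_ge0 ?invr_ge0 ?(ltW c0) //.
  rewrite !exprMn exprVn.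
  have -> : (c ^+ 2)^-1 = 1 + tau * k ^+ 2.
    apply/esym/(mulfI (lt0r_neq0 (exprn_gt0 2 c0))).
    by rewrite c2 mulfV // lt0r_neq0 // exprn_gt0.
  rewrite addrAC subrr add0r mulr1; lra.
have Diter n t : 0 <= t -> D (t + n%:R) <= c ^+ n * D t.
  move=> t0; elim: n => [|n IHn]; first by rewrite addr0 expr0 mul1r.
  rewrite -natr1 addrA exprS -mulrA; apply: le_trans (Dstep _ _) _.
    by rewrite addr_ge0.
  by rewrite ler_pM2l.
have Dfloor t : 0 <= t -> D t <= c ^ Num.floor t * D 0.
  move=> t0; have := floor_itv t; have := floor_ge0 t; rewrite t0.
  case: (Num.floor t) => // n _ /andP[nt _]; rewrite /= in nt.
  have nt' : 0 <= t - n%:R by rewrite subr_ge0.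
  rewrite -[t](subrK n%:R); apply: le_trans (Diter n _ nt') _.
  by rewrite ler_wpM2l ?exprn_ge0 ?(ltW c0) // Dmono // lexx.
split; first by rewrite c0.
move=> t s t0 s0; rewrite -x0E !DE -!EFinM !lee_fin.
split; first exact: Dfloor.
suff : 2^-1 * `|x t - x (t + s)| <= D t by have := Dfloor t t0; lra.
apply/DP => p Tp; have := fejer p t (t + s) Tp ltac:(lra).
have := ler_distD p (x t) (x (t + s)); rewrite (distrC p); lra.
Qed.
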